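(* Let $\kappa$ be inaccessible and let $b:\kappa\to\kappa$ be an increasing function such that each $b(\alpha)$ is an infinite cardinal. For each regular cardinal $\lambda<\kappa$ let $D_\lambda=\{\alpha\in\kappa\mid\mathrm{cf}(b(\alpha))=\lambda\}$. (i) If there exists a least regular cardinal $\lambda<\kappa$ such that $D_\lambda$ is cofinal in $\kappa$, then $\mathfrak b_\kappa^b(\leq^* )=\lambda$. (ii) If $D_\lambda$ is bounded in $\kappa$ for all regular $\lambda<\kappa$ and there exists a stationary set $S\subseteq\kappa$ such that for each $\xi\in S$ there exists $\alpha_\xi\geq\xi$ with $\mathrm{cf}(b(\alpha_\xi))\leq\xi$, then $\mathfrak b_\kappa^b(\leq^* )=\kappa$. (iii) If $D_\lambda$ is bounded in $\kappa$ for all regular $\lambda<\kappa$ and there exists a club set $C\subseteq\kappa$ such that for each $\xi\in C$ we have $\mathrm{cf}(b(\alpha))>\xi$ for all $\alpha\geq\xi$, then $\mathfrak b_\kappa^b(\leq^* )\geq\kappa^+$.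
   Context: ''Increasing'' means not necessarily strictly increasing. $\prod b$ is the set of functions $f$ with domain $\kappa$ and $f(\alpha)\in b(\alpha)$ for all $\alpha\in\kappa$. $f\leq^*g$ means that there is $\beta<\kappa$ with $f(\alpha)\leq g(\alpha)$ for all $\alpha>\beta$. The unbounding number $\mathfrak b_\kappa^b(\leq^* )$ is the least size of a set $B\subseteq\prod b$ such that there is no $g\in\prod b$ with $f\leq^*g$ for all $f\in B$. *)

(* Defs.v *)
From HB Require Import structures.
From mathcomp Require Import all_boot all_order.
From mathcomp Require Import all_classical wochoice.

Set Implicit Arguments.
Unset Strict Implicit.
Unset Printing Implicit Defensive.

Import Order.TTheory.
Local Open Scope order_scope.
Local Open Scope classical_set_scope.
Local Open Scope card_scope.

(* An initial ordinal kappa is modelled by a well-ordered type K: the elements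
   of K are the ordinals below kappa, the ordinal x is identified with the set
   [below x] of its predecessors, and [set: K] plays the role of kappa itself.
   Cardinalities are compared with MathComp-Analysis' [#<=] and [#=], so that
   cardinals that need not lie below kappa are represented by sets having that
   cardinality. *)

Definition card_lt T U (A : set T) (B : set U) : Prop :=
  A #<= B /\ ~ (B #<= A).

(* |Y| = |X|^+ *)
Definition is_succ_card T U (X : set T) (Y : set U) : Prop :=
  card_lt X Y /\ forall V (Z : set V), card_lt X Z -> Y #<= Z.

Section Ordinals.
Context {d : Order.disp_t} {K : orderType d}.
Implicit Types (x y l : K) (A C D S X : set K).

Definition below x : set K := [set y | y < x].

Definition cofinal_in A X : Prop :=
  A `<=` X /\ forall x, X x -> exists2 a, A a & x <= a.

Definition is_least A x : Prop := A x /\ lbound A x.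

(* cf(x) is the least cardinality of a cofinal subset of x; the default value
   of [xget] is never used when K is well-ordered, see [cf_is_least]. *)
Definition cf x : K :=
  xget x (is_least [set l | exists2 A, cofinal_in A (below x) & A #= below l]).

Definition is_cardinal x : Prop :=
  forall y, y < x -> card_lt (below y) (below x).

Definition is_infinite_cardinal x : Prop :=
  is_cardinal x /\ infinite_set (below x).

Definition is_regular x : Prop := is_infinite_cardinal x /\ cf x = x.

(* C is closed under limits: a nonzero x below which C is unbounded is in C. *)
Definition closed_in_kappa C : Prop :=
  forall x, below x !=set0 ->
    (forall y, y < x -> exists2 c, C c & y < c < x) -> C x.

Definition is_club C : Prop := cofinal_in C [set: K] /\ closed_in_kappa C.

Definition is_stationary S : Prop :=
  forall C, is_club C -> S `&` C !=set0.

(* The product of b, as a set of functions from kappa to kappa. *)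
Definition prod_below (b : K -> K) : set (K -> K) :=
  [set f | forall a, f a < b a].

Definition le_star (f g : K -> K) : Prop :=
  exists beta, forall a, beta < a -> f a <= g a.

Definition is_unbounded (b : K -> K) (B : set (K -> K)) : Prop :=
  B `<=` prod_below b /\
  ~ exists2 g, prod_below b g & forall f, B f -> le_star f g.

(* |X| is the least size of an unbounded subset of the product of b, that is,
   the unbounding number of b is |X|. *)
Definition is_unbounding_number (b : K -> K) T (X : set T) : Prop :=
  (exists2 B, is_unbounded b B & B #= X) /\
  forall B, is_unbounded b B -> X #<= B.

(* cf(b(a)) = l *)
Definition cof_level (b : K -> K) l : set K := [set a | cf (b a) = l].

Lemma cf_is_least x : well_order (<=%O : rel K) ->
  is_least [set l | exists2 A, cofinal_in A (below x) & A #= below l] (cf x).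
Proof.
move=> wo; rewrite /cf; set L := (X in is_least X).
apply: xgetPex.
have Lx : L x.
  exists (below x); last exact: card_eqxx.
  by split=> // y yx; exists y.
have [|z [[/set_mem Lz lbz] _]] := wo (mem L).
  by exists x; rewrite inE.
exists z; split=> // y Ly; exact/lbz/mem_set.
Qed.

End Ordinals.

(* kappa is an uncountable, regular, strong limit cardinal. *)
Definition inaccessible {d : Order.disp_t} (K : orderType d) : Prop :=
  [/\ well_order (<=%O : rel K),
      (forall x : K, card_lt (below x) [set: K]),
      card_lt [set: nat] [set: K],
      (forall A : set K, cofinal_in A [set: K] -> A #= [set: K]) &
      (forall x : K, is_cardinal x ->
         card_lt [set A : set K | A `<=` below x] [set: K])].

(* Main.v *)
(* Fix for every a a cofinal family (c_i(a)), i < cf(b(a)), in b(a).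

   A family of fewer than cf(b(a)) functions is bounded at the coordinate a.
   As kappa is regular, if D_m is bounded for all regular m < l, then
   l <= cf(b(a)) for all large a, so a set of fewer than l functions is bounded;
   this gives the lower bounds in (i) and (ii).

   For the upper bounds, the functions c_i are unbounded as soon as, whenever
   each i is given a threshold h(i), some a satisfies h(i) < a for all
   i < cf(b(a)): then g >= c_i beyond h(i) fails at a. In (i) such an a is found
   in D_l above sup h; in (ii) it is a_x for x in S closed under h.

   In (iii), a sequence of kappa functions f_i is bounded by diagonalising
   along C: at a, bound only the f_i with i < max(C `&` [0, a]) < cf(b(a)). *)
Require Import Defs.
From mathcomp Require Import all_boot all_order.
From mathcomp Require Import all_classical wochoice.

Set Implicit Arguments.
Unset Strict Implicit.
Unset Printing Implicit Defensive.

Import Order.TTheory.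
Local Open Scope order_scope.
Local Open Scope classical_set_scope.
Local Open Scope card_scope.

(** * Comparison of cardinalities *)

(** A relation needs no values outside [A], so injections can be given even when no total function
    from [T] to [U] is at hand. *)
Lemma card_le_relP T U (A : set T) (B : set U) :
  A #<= B <-> exists2 G : T -> U -> Prop,
    (forall x, A x -> exists2 y, B y & G x y) &
    (forall x x' y, A x -> A x' -> G x y -> G x' y -> x = x').
Proof.
split=> [/card_leP[f]|[G tG iG]].
  exists (fun x y => exists2 u : A, val u = x & val (f u) = y).
    move=> x Ax; exists (val (f (SigSub (mem_set Ax)))).
      by apply: set_mem; exact: valP.
    by exists (SigSub (mem_set Ax)).
  move=> _ _ y _ _ [u <- <-] [v <-] /val_inj fE.
  by congr val; apply/esym; apply: (@inj _ _ _ f) fE; rewrite inE.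
have tG' (u : A) : {v : B | G (val u) (val v)}.
  apply/cid; have [y By Guy] := tG _ (set_mem (valP u)).
  by exists (SigSub (mem_set By)).
apply/card_leP/injfunPex; exists (fun u => sval (tG' u)) => // u v _ _ uv.
have := svalP (tG' u); rewrite uv => Gu; have Gv := svalP (tG' v).
apply: val_inj; apply: iG Gu Gv; [exact: set_mem (valP u)|].
exact: set_mem (valP v).
Qed.

(** Invert the injection and send every point without a preimage in [A] to [x0]. *)
Lemma card_le_surj T U (A : set T) (B : set U) : A !=set0 -> A #<= B ->
  exists2 f : U -> T, (forall y, A (f y)) & A `<=` f @` B.
Proof.
move=> [x0 Ax0] /card_le_relP[G tG iG].
have /choice[f fP] : forall y, exists x, A x /\
    forall x', A x' -> G x' y -> x = x'.
  move=> y; have [[x [Ax Gxy]]|nx] := pselect (exists x, A x /\ G x y).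
    by exists x; split=> // x' Ax' Gx'y; exact: iG Gxy Gx'y.
  by exists x0; split=> // x Ax Gxy; case: nx; exists x.
exists f => [y|x Ax]; first by case: (fP y).
have [y By Gxy] := tG x Ax; exists y => //.
by have [_] := fP y; apply.
Qed.

Lemma card_le_total T U (A : set T) (B : set U) : A #<= B \/ B #<= A.
Proof.
(* A maximal partial injection is total or surjective. *)
pose P (G : set (T * U)) := [/\ G `<=` A `*` B,
  (forall x y y', G (x, y) -> G (x, y') -> y = y') &
  (forall x x' y, G (x, y) -> G (x', y) -> x = x')].
have [F FP Ftot|G [[GAB Gf Gi] Gmax]] := @Zorn_bigcup _ P.
  have up p q : (\bigcup_(X in F) X) p -> (\bigcup_(X in F) X) q ->
      exists X, [/\ F X, X p & X q].
    move=> [X FX Xp] [Y FY Yq].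
    by case: (Ftot _ _ FX FY) => XY; [exists Y|exists X]; split=> //; exact: XY.
  split.
  - by move=> p [X FX Xp]; have [+ _ _] := FP _ FX; exact.
  - by move=> x y y' Fy /(up _ _ Fy)[X [/FP[_ + _]]]; exact.
  - by move=> x x' y Fx /(up _ _ Fx)[X [/FP[_ _ +]]]; exact.
have [Adom|/existsNP[x /not_implyP[Ax nx]]] :=
    pselect (forall x, A x -> exists2 y, B y & G (x, y)).
  left; apply/card_le_relP; exists (fun x y => G (x, y)) => //.
  by move=> x x' y _ _; exact: Gi.
have [Bdom|/existsNP[y /not_implyP[By ny]]] :=
    pselect (forall y, B y -> exists2 x, A x & G (x, y)).
  right; apply/card_le_relP; exists (fun y x => G (x, y)) => //.
  by move=> y y' u _ _; exact: Gf.
have {}nx y' : ~ G (x, y').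
  by move=> Gxy; apply: nx; exists y' => //; case: (GAB _ Gxy).
have {}ny x' : ~ G (x', y).
  by move=> Gxy; apply: ny; exists x' => //; case: (GAB _ Gxy).
exfalso; apply: (Gmax (G `|` [set (x, y)])).
  split=> [p|/(_ (x, y))]; first by left.
  by move=> /(_ (or_intror erefl)); exact: nx.
split.
- by move=> p [/GAB//|->].
- move=> u v v' [G1|[-> ->]] [G2|[// E ->]]; first exact: Gf G1 G2.
    by case: (nx v); rewrite -E.
  by case: (nx _ G2).
- move=> u u' v [G1|[-> ->]] [G2|[-> // E]]; first exact: Gi G1 G2.
    by case: (ny u); rewrite -E.
  by case: (ny _ G2).
Qed.

Lemma card_lt_setT_powerset T : card_lt [set: T] [set: set T].
Proof.
split.
  apply/card_le_relP; exists (fun x X => X = [set x]) => [x _|x x' X _ _ -> E].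
    by exists [set x].
  by have : [set x'] x by rewrite -E.
move=> /card_le_surj[|f _ fS]; first by exists set0.
have [x _ fx] := fS [set x | ~ f x x] I.
have [fxx|nfxx] := pselect (f x x).
  by have := fxx; rewrite {1}fx.
by apply: (nfxx); rewrite fx.
Qed.

Lemma card_setU1 T (X : set T) (a : T) : infinite_set X ->
  X `|` [set a] #<= X.
Proof.
move=> /infiniteP Xinf.
have [f fX fi] : exists2 f : nat -> T, (forall n, X (f n)) & injective f.
  have /card_le_relP[G tG iG] := Xinf.
  have /choice[f fP] : forall n, exists x, X x /\ G n x.
    by move=> n; have [x] := tG n I; exists x.
  exists f => [n|m n fmn]; first by case: (fP n).
  have [_ Gm] := fP m; have [_] := fP n; rewrite -fmn => Gn.
  exact: iG Gm Gn.
have [Xa|nXa] := pselect (X a).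
  by apply: subset_card_le => x [|->].
(* Shift along a copy of nat inside X, sending a to its origin. *)
apply/card_le_relP.
exists (fun x y => [\/ x = a /\ y = f 0, exists2 n, x = f n & y = f n.+1
  | [/\ x <> a, (forall n, x <> f n) & y = x]]).
  move=> x [Xx|->]; last by exists (f 0) => //; constructor 1.
  have [[n xn]|nx] := pselect (exists n, x = f n).
    by exists (f n.+1) => //; constructor 2; exists n.
  exists x => //; constructor 3; split=> // [xa|n xn].
    by apply: nXa; rewrite -xa.
  by apply: nx; exists n.
move=> x x' y _ _.
case=> [[-> ->]|[n -> ->]|[xa nf ->]] [[-> E]|[m -> E]|[xa' nf' E]] //;
  try by move/fi: E.
- by case: (nf' 0).
- by move/fi: E => [->].
- by case: (nf' n.+1).
- by case: (nf 0).
- by case: (nf m.+1).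
Qed.

(** * Well-orders, the Mostowski collapse and least cardinalities *)

Section Collapse.
Variables (T : choiceType) (R : rel T).
Hypothesis wo : well_order R.

Lemma wo_minimum (A : set T) : A !=set0 ->
  exists2 z, A z & forall x, A x -> R z x.
Proof.
move=> [x Ax]; have [|z [[/set_mem Az lbz] _]] := wo (A := mem A).
  by exists x; exact: mem_set.
by exists z => // y Ay; exact/lbz/mem_set.
Qed.

Let Rtotal x y : R x y || R y x.
Proof. by apply: (@wo_chainW T R predT) => // A _; exact: wo. Qed.

Let Ranti x y : R x y -> R y x -> x = y.
Proof.
move=> xy yx; apply: (@wo_chain_antisymmetric T R predT) => //.
  by move=> A _; exact: wo.
by rewrite xy yx.
Qed.

(** [well_order] speaks only of least elements. If the least of [x], [y], [z] is not [x],
    antisymmetry identifies two neighbours in the chain. *)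
Lemma wo_trans : transitive R.
Proof.
move=> y x z xy yz.
have [|m mE mmin] := @wo_minimum [set m | [\/ m = x, m = y | m = z]].
  by exists x; constructor 1.
have mx : R m x by apply: mmin; constructor 1.
have my : R m y by apply: mmin; constructor 2.
have mz : R m z by apply: mmin; constructor 3.
case: mE => mE; rewrite mE // in mx my mz *.
- by rewrite -(Ranti mx xy).
- by rewrite (Ranti yz my) in xy.
Qed.

Let wf : well_founded (fun x y => ~~ R y x).
Proof.
move=> x; apply: contrapT => nx.
have [z nz zmin] : exists2 z, ~ Acc (fun x y => ~~ R y x) z &
    forall x, ~ Acc (fun x y => ~~ R y x) x -> R z x.
  by apply: (@wo_minimum [set z | ~ Acc (fun x y => ~~ R y x) z]); exists x.
apply: nz; constructor=> y /negP zy; apply: contrapT => ny.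
exact/zy/zmin.
Qed.

Variable A : set T.

(* The Mostowski collapse of A: each point is sent to the least point that is
   not the image of an earlier element of A. *)
Let avoid x (p : forall y, ~~ R x y -> T) :=
  [set z | forall y (yx : ~~ R x y), A y -> p y yx <> z].

Let step x (p : forall y, ~~ R x y -> T) : T :=
  xget x [set z | avoid p z /\ forall u, avoid p u -> R z u].

Let collapse : T -> T := Fix wf (fun _ => T) step.

Let collapseE x : collapse x = step (fun y (_ : ~~ R x y) => collapse y).
Proof.
rewrite /collapse Fix_eq // => y p q pq.
by congr step; apply: functional_extensionality_dep => z; apply/funext.
Qed.

Let collapse_spec x :
  [/\ (forall y, ~~ R x y -> A y -> collapse y <> collapse x),
      (forall z, (forall y, ~~ R x y -> A y -> collapse y <> z) ->
         R (collapse x) z) &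
      R (collapse x) x].
Proof.
elim/(well_founded_ind wf): x => x IH.
(* Earlier images satisfy [R (collapse y) y], so none equals [x]. Hence a least avoided point exists
   and the default of [xget] is never taken. *)
have xx : avoid (fun y (_ : ~~ R x y) => collapse y) x.
  move=> y xy _ yE; have [_ _] := IH y xy.
  by rewrite yE (negbTE xy).
rewrite [collapse x]collapseE /step; case: xgetP => [z _ [az zmin]|].
  split; [exact: az|exact: zmin|exact: zmin].
have [|z az zmin] := @wo_minimum (avoid (fun y (_ : ~~ R x y) => collapse y)).
  by exists x.
by move=> /(_ z)[].
Qed.

(** The collapse is injective on [A] and its image is an initial segment: all of [T], or the points
    before the least non-image [l]. As the collapse never moves a point up, in the first case [A] is
    cofinal, and in the second a strict upper bound of [A] is not an image. *)
Lemma card_initial_segment :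
  A #= [set: T] /\ (forall x, exists2 a, A a & R x a) \/
  exists2 l, A #= [set y | ~~ R l y] &
    forall x, (forall a, A a -> ~~ R x a) -> R l x.
Proof.
have cA : collapse @` A #= A.
  apply: inj_card_eq => x y /set_mem Ax /set_mem Ay xy.
  have [cx _ _] := collapse_spec x; have [cy _ _] := collapse_spec y.
  apply: Ranti; apply: contrapT => /negP nR; first exact: cx nR Ay (esym xy).
  exact: cy nR Ax xy.
have down x z : A x -> ~~ R (collapse x) z -> (collapse @` A) z.
  move=> Ax; apply: contraNP => nz; have [_ + _] := collapse_spec x; apply.
  by move=> y _ Ay yz; apply: nz; exists y.
have [full|/existsNP[z nz]] := pselect (forall z, (collapse @` A) z).
  left; split=> [|x]; last first.
    have [a Aa <-] := full x; exists a => //.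
    by case: (collapse_spec a).
  rewrite card_eq_sym; suff <- : collapse @` A = setT by [].
  by apply/seteqP; split.
right; have [|l nl lmin] := @wo_minimum (~` (collapse @` A)).
  by exists z.
exists l.
  rewrite card_eq_sym; suff <- : collapse @` A = [set y | ~~ R l y] by [].
  apply/seteqP; split=> [_ [a Aa <-]|y /=].
    apply/negP => la; apply: nl; have [al|/negP al] := pselect (R (collapse a) l).
      by exists a => //; exact: Ranti.
    exact: down al.
  by apply: contraNP => ny; exact: lmin.
move=> x xA; apply: lmin => -[a Aa ax].
have [_ _] := collapse_spec a.
by rewrite ax (negbTE (xA _ Aa)).
Qed.

End Collapse.

(** Well-order [T] and take a member of [P] whose collapse is the shortest proper initial segment.
    If no member collapses to a proper one, all have the size of [T]. *)
Lemma min_card T (P : set (set T)) : P !=set0 ->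
  exists2 X, P X & forall Y, P Y -> X #<= Y.
Proof.
move=> [X0 PX0].
have [R wo] := well_ordering_principle {classic T}.
have seg (X : set T) := @card_initial_segment {classic T} R wo X.
have [[l0 Pl0]|nP] :=
    pselect (exists l, exists2 X, P X & X #= [set y | ~~ R l y]).
  have [|l [X PX Xl] lmin] := wo_minimum wo
    (A := [set l | exists2 X, P X & X #= [set y | ~~ R l y]]).
    by exists l0.
  exists X => // Y PY; case: (seg Y) => [[YT _]|[m Ym _]].
    by rewrite (card_le_eqr YT); exact: card_leT.
  rewrite (card_le_eql Xl) (card_le_eqr Ym); apply: subset_card_le => y /=.
  by apply: contraNN => my; apply: (wo_trans wo) my; apply: lmin; exists Y.
exists X0 => // Y PY; case: (seg Y) => [[YT _]|[m Ym _]].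
  by rewrite (card_le_eqr YT); exact: card_leT.
by case: nP; exists m, Y.
Qed.

(** * Cofinality in a well-order *)

Section WellOrder.
Context {d : Order.disp_t} {K : orderType d}.
Hypothesis wo : well_order (<=%O : rel K).
Implicit Types (x y l : K) (A : set K).

Lemma card_initial_segment_below A :
  A #= [set: K] /\ cofinal_in A [set: K] \/
  exists2 l, A #= below l & forall x, A `<=` below x -> l <= x.
Proof.
case: (card_initial_segment wo A) => [[AK Acof]|[l Al lmin]].
  by left; split=> //; split=> // x _; exact: Acof.
right; exists l => [|x Ax]; last by apply: lmin => a /Ax; rewrite /below /= ltNge.
suff -> : below l = [set y | ~~ (l <= y)] by [].
by apply/seteqP; split=> y; rewrite /below /= ltNge.
Qed.

Lemma below_sub x y : x <= y -> below x `<=` below y.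
Proof. by move=> xy z /lt_le_trans; apply. Qed.

Lemma cf_le x : cf x <= x.
Proof.
have [_] := cf_is_least x wo; apply; exists (below x).
  by split=> // y yx; exists y.
exact: card_eqxx.
Qed.

Lemma cofinal_card_cf x : exists2 A, cofinal_in A (below x) & A #= below (cf x).
Proof. by have [] := cf_is_least x wo. Qed.

(** [cf] minimises over ordinals, so [A] is first collapsed onto some [below l], which makes [l] a
    competitor. *)
Lemma cf_le_card A x : cofinal_in A (below x) -> below (cf x) #<= A.
Proof.
move=> Ax; have [[_ [_ Acof]]|[l Al lx]] := card_initial_segment_below A.
  have [a Aa xa] := Acof x I.
  by have := Ax.1 _ Aa; rewrite /below /= ltNge xa.
rewrite (card_le_eqr Al); apply/subset_card_le/below_sub.
by have [_] := cf_is_least x wo; apply; exists A.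
Qed.

Lemma not_cofinal A x : A `<=` below x -> ~ cofinal_in A (below x) ->
  exists2 y, y < x & forall a, A a -> a < y.
Proof.
move=> Ax nA; apply: contrapT => ny; apply: nA; split=> // y yx.
apply: contrapT => na; apply: ny; exists y => // a Aa; rewrite ltNge.
by apply/negP => ya; apply: na; exists a.
Qed.

(** [I] is arbitrary because the lemma is mostly applied to sets of functions, with [F] the
    evaluation at a coordinate. *)
Lemma small_family_bounded I (S : set I) (F : I -> K) x :
  ~ (below (cf x) #<= S) -> (forall i, S i -> F i < x) ->
  exists2 y, y < x & forall i, S i -> F i < y.
Proof.
move=> nS Fx; have [|/cf_le_card FS|y yx yF] := @not_cofinal (F @` S) x.
- by move=> _ [i Si <-]; exact: Fx.
- by apply: nS; apply: card_le_trans FS _; exact: card_image_le.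
- by exists y => // i Si; apply: yF; exists i.
Qed.

(** Otherwise [x] is the successor of [y], and an infinite set absorbs one more point, so [x] and
    [y] have the same size. *)
Lemma infinite_cardinal_limit x y : is_infinite_cardinal x -> y < x ->
  exists2 z, y < z & z < x.
Proof.
move=> [xcard xinf] yx; apply: contrapT => nz.
have xE : below x = below y `|` [set y].
  apply/seteqP; split=> [z /= zx|z /= [/lt_trans|->//]]; last by apply.
  have [zy|yz|->] := ltgtP z y; [by left| |by right].
  by case: nz; exists z.
have yinf : infinite_set (below y).
  move=> yfin; apply: xinf; rewrite xE finite_setU; split=> //.
by have [_] := xcard y yx; apply; rewrite xE; exact: card_setU1.
Qed.

Lemma infinite_cardinal_gt0 x : is_infinite_cardinal x -> exists y, y < x.
Proof. by move=> [_ /infinite_setN0[y yx]]; exists y. Qed.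

Lemma is_cardinal_cf x : is_cardinal (cf x).
Proof.
move=> y yx; split; first by apply/subset_card_le/below_sub/ltW.
move=> xy; suff : cf x <= y by rewrite leNgt yx.
have [A Ax Acf] := cofinal_card_cf x.
have [_] := cf_is_least x wo; apply; exists A => //.
apply: card_eq_trans Acf _; apply: Cantor_Bernstein => //.
exact/subset_card_le/below_sub/ltW.
Qed.

(** Finitely many points below a limit ordinal have a common bound below it. *)
Lemma infinite_cf x : is_infinite_cardinal x -> infinite_set (below (cf x)).
Proof.
move=> xic [n xn]; have [A [Ax Acof] Acf] := cofinal_card_cf x.
have An := card_eq_trans Acf xn.
have [y0 y0x] := infinite_cardinal_gt0 xic.
have [| |f fA Af] := @card_le_surj _ _ A `I_n.
- by have [a] := Acof _ y0x; exists a.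
- by have /card_eqPle[] := An.
have bnd m : exists2 y, y < x & forall i, (i < m)%N -> f i < y.
  elim: m => [|m [y yx ym]]; first by exists y0.
  have /(infinite_cardinal_limit xic)[z fz zx] : Order.max y (f m) < x.
    by rewrite gt_max yx; exact: Ax.
  exists z => // i; rewrite ltnS leq_eqVlt => /predU1P[->|/ym iy].
    by apply: le_lt_trans fz; rewrite le_max lexx orbT.
  by apply: lt_trans iy (le_lt_trans _ fz); rewrite le_max lexx.
have [y yx yf] := bnd n; have [a Aa] := Acof _ yx.
by have [i /yf + <-] := Af _ Aa; rewrite leNgt => ->.
Qed.

(** Ensures that every value [cf (b a)] is one of the regular cardinals whose levels the theorem
    controls. A cofinal subset of [cf x] of smaller size would be carried to a cofinal subset of [x]
    smaller than [cf x]. *)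
Lemma regular_cf x : is_infinite_cardinal x -> is_regular (cf x).
Proof.
move=> xic; have cic : is_infinite_cardinal (cf x).
  by split; [exact: is_cardinal_cf|exact: infinite_cf].
split=> //; apply/eqP; rewrite eq_le cf_le leNgt; apply/negP => lt_cf.
have [A [Ax Acof] Acf] := cofinal_card_cf x.
have [E [Ex Ecof] Ecf] := cofinal_card_cf (cf x).
have [y0 y0x] := infinite_cardinal_gt0 xic.
have [| |f fA Af] := @card_le_surj _ _ A (below (cf x)).
- by have [a] := Acof _ y0x; exists a.
- by have /card_eqPle[] := Acf.
(* h i bounds the first elements of A, so h maps cofinal sets to cofinal sets. *)
have /choice[h hP] : forall i, exists y, i < cf x ->
    y < x /\ forall j, j <= i -> f j < y.
  move=> i; have [ic|] := boolP (i < cf x); last by exists i.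
  have [|j _|y yx yf] := @small_family_bounded _ [set j | j <= i] f x.
  - have [z iz zc] := infinite_cardinal_limit cic ic.
    move=> ci; have [_] := is_cardinal_cf zc; apply.
    apply: card_le_trans ci _; apply: subset_card_le => j /= /le_lt_trans.
    by apply.
  - exact: Ax.
  - by exists y.
have [_] := is_cardinal_cf lt_cf; apply.
rewrite -(card_le_eqr Ecf); apply: card_le_trans (card_image_le h E).
apply: cf_le_card; split=> [_ [i Ei <-]|y yx].
  by have [] := hP i (Ex _ Ei).
have [a Aa ya] := Acof y yx; have [j jc ja] := Af a Aa.
have [i Ei ji] := Ecof j jc; exists (h i); first by exists i.
by apply: le_trans ya _; rewrite -ja ltW// (hP i (Ex _ Ei)).2.
Qed.

End WellOrder.

(** * Regularity of kappa and club sets *)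

Section Inaccessible.
Context {d : Order.disp_t} {K : orderType d}.
Hypothesis hK : inaccessible K.
Implicit Types (x y l : K) (A C : set K).

Let wo : well_order (<=%O : rel K). Proof. by case: hK. Qed.

Lemma below_small x : ~ ([set: K] #<= below x).
Proof. by case: hK => _ /(_ x)[]. Qed.

(** Kappa is not an element of [K], so its regularity enters through the size of cofinal sets and
    not through [cf]. *)
Lemma small_family_bounded_kappa I (S : set I) (F : I -> K) :
  ~ ([set: K] #<= S) -> exists x, forall i, S i -> F i < x.
Proof.
move=> nS; apply: contrapT => nx; apply: nS.
have [_ _ _ cofK _] := hK; have /cofK/card_eqPle[_ KF] :
    cofinal_in (F @` S) [set: K].
  split=> // x _; apply: contrapT => na; apply: nx; exists x => i Si.
  by rewrite ltNge; apply/negP => xi; apply: na; exists (F i) => //; exists i.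
exact: card_le_trans KF (card_image_le _ _).
Qed.

Lemma no_max x : exists y, x < y.
Proof.
have [|y /(_ x erefl) xy] := @small_family_bounded_kappa _ [set x] id.
  move=> Kx; have [_ _ [natK _] _ _] := hK.
  have /infiniteP := card_le_trans natK Kx; apply; exact: finite_set1.
by exists y.
Qed.

(** For unboundedness, iterate countably often a map [s] that bounds [h] on initial segments. The
    supremum [z] of the iterates lies below kappa, which is regular and uncountable. *)
Lemma closure_points_club (h : K -> K) :
  is_club [set x | forall y, y < x -> h y < x].
Proof.
split; last first.
  move=> x _ xlim y /xlim[c hc /andP[yc cx]].
  exact: lt_trans (hc _ yc) cx.
split=> // x0 _.
have /choice[s sP] : forall x, exists z, x < z /\ forall y, y < x -> h y < z.
  move=> x; have [z zP] := small_family_bounded_kappa h (@below_small x).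
  have [w] := no_max (Order.max x z); rewrite gt_max => /andP[xw zw].
  by exists w; split=> // y /zP yz; exact: lt_trans yz zw.
pose u n := iter n s x0.
have uS n : u n < u n.+1 by have [] := sP (u n).
have [|z0 z0P] := @small_family_bounded_kappa _ [set: nat] u.
  by case: hK => _ _ [].
have [|z zu zmin] := wo_minimum wo (A := [set z | forall n, u n < z]).
  by exists z0 => n; exact: z0P.
exists z; last exact/ltW/(zu 0).
move=> y yz; have [n yn] : exists n, y <= u n.
  apply: contrapT => ny; move: yz; rewrite ltNge zmin// => n.
  by rewrite ltNge; apply/negP => yn; apply: ny; exists n.
(* [sP] needs [y] strictly below its argument, hence the detour through [u n.+1]:
   [h y < u n.+2 < z]. *)
have [_ /(_ y (le_lt_trans yn (uS n)))] := sP (u n.+1).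
by move=> /lt_trans; apply; exact: (zu n.+2).
Qed.

(** Let [z] be the supremum of the points of [C] up to [x]. Were it not in [C], it would be a limit
    of such points, and closure would put it there; [c] keeps it nonzero. *)
Lemma club_max C x c : is_club C -> C c -> c <= x ->
  exists z, [/\ C z, z <= x & forall c', C c' -> c' <= x -> c' <= z].
Proof.
move=> [_ Ccl] Cc cx.
have [|z zub zmin] := wo_minimum wo
    (A := [set z | forall c', C c' -> c' <= x -> c' <= z]).
  by exists x.
exists z; split=> //; last exact: zmin.
apply: contrapT => nCz.
have ltz c' : C c' -> c' <= x -> c' < z.
  move=> Cc' c'x; rewrite lt_neqAle zub// andbT; apply/eqP => c'z.
  by apply: nCz; rewrite -c'z.
apply: nCz; apply: Ccl => [|y yz]; first by exists c; exact: ltz.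
apply: contrapT => nc; move: yz; rewrite ltNge zmin// => c' Cc' c'x.
rewrite leNgt; apply/negP => yc'; apply: nc; exists c' => //.
by rewrite yc' ltz.
Qed.

(** * Bounded and unbounded families in the product; case (i) *)

Variable b : K -> K.
Hypothesis hb_card : forall a, is_infinite_cardinal (b a).

Lemma small_set_bounded (B : set (K -> K)) x : B `<=` prod_below b ->
  (forall a, x <= a -> ~ (below (cf (b a)) #<= B)) ->
  exists2 g, prod_below b g & forall f, B f -> le_star f g.
Proof.
move=> Bb smallB.
have /choice[g gP] : forall a, exists y,
    y < b a /\ (x <= a -> forall f, B f -> f a < y).
  move=> a; have [xa|] := boolP (x <= a); last first.
    by have [y] := infinite_cardinal_gt0 (hb_card a); exists y.
  have [|y yb yP] :=
      small_family_bounded wo (F := fun f : K -> K => f a) (smallB a xa).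
    by move=> f Bf; exact: Bb.
  by exists y; split=> // _ f; exact: yP.
exists g => [a|f Bf]; first by case: (gP a).
exists x => a /ltW xa; apply/ltW.
by have [_ /(_ xa)] := gP a; apply.
Qed.

Lemma cf_eventually_ge l :
  (forall m, m < l -> is_regular m ->
     exists x, forall a, cof_level b m a -> a < x) ->
  exists x, forall a, x <= a -> l <= cf (b a).
Proof.
move=> bnd.
have /choice[h hP] : forall m, exists x, m < l -> is_regular m ->
    forall a, cof_level b m a -> a < x.
  move=> m; have [[ml mreg]|nm] := pselect (m < l /\ is_regular m).
    by have [x xP] := bnd m ml mreg; exists x.
  by exists m => ml mreg; case: nm.
have [x xP] := small_family_bounded_kappa h (@below_small l).
(* If [cf (b a) < l], then [a] lies in the level of a regular cardinal below [l], hence below that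
   level's bound. *)
exists x => a xa; rewrite leNgt; apply/negP => al.
have := hP _ al (regular_cf wo (hb_card a)) a erefl.
by rewrite ltNge (le_trans (ltW (xP _ al)) xa).
Qed.

(** Distinct indices may give the same function: the lower bound, applied to the image of [X]
    itself, supplies the inequality that injectivity would give. *)
Lemma unbounding_numberI T (X : set T) (F : T -> K -> K) :
  is_unbounded b (F @` X) ->
  (forall B, is_unbounded b B -> X #<= B) -> is_unbounding_number b X.
Proof.
move=> FX lb; split=> //; exists (F @` X) => //.
by apply: Cantor_Bernstein; [exact: card_image_le|exact: lb].
Qed.

(** Enumerate a cofinal subset of each [b a]. The enumeration stays in that set also at indices from
    [cf (b a)] on, so each [c i] is in the product. The strict inequality uses that [b a] is a
    limit. *)
Lemma cofinal_family : exists2 c : K -> K -> K, (forall i, prod_below b (c i)) &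
  forall a y, y < b a -> exists2 i, i < cf (b a) & y < c i a.
Proof.
have /choice[e eP] : forall a, exists e : K -> K, (forall i, e i < b a) /\
    forall y, y < b a -> exists2 i, i < cf (b a) & y < e i.
  move=> a; have [A [Ab Acof] /card_eqPle[Acf _]] := cofinal_card_cf wo (b a).
  have [y0 y0b] := infinite_cardinal_gt0 (hb_card a).
  have [|e eA Ae] := card_le_surj _ Acf.
    by have [z] := Acof _ y0b; exists z.
  exists e; split=> [i|y yb]; first exact/Ab/eA.
  have [z yz /Acof[w /Ae[i ic <-] zi]] :=
    infinite_cardinal_limit (hb_card a) yb.
  by exists i => //; exact: lt_le_trans zi.
exists (fun i a => e a i) => [i a|a]; first by case: (eP a).
by case: (eP a).
Qed.

(** The index set [I] will be [below l] in (i) and all of [K] in (ii). *)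
Lemma cofinal_family_unbounded (c : K -> K -> K) (I : set K) :
  (forall i, prod_below b (c i)) ->
  (forall a y, y < b a -> exists2 i, i < cf (b a) & y < c i a) ->
  (forall h : K -> K, exists a, forall i, i < cf (b a) -> I i /\ h i < a) ->
  is_unbounded b (c @` I).
Proof.
move=> cb ccof hI; split=> [_ [i _ <-]//|[g gb cg]].
have /choice[h hP] : forall i, exists x, I i ->
    forall a, x < a -> c i a <= g a.
  move=> i; have [Ii|] := pselect (I i); last by exists i.
  by have [|x xP] := cg (c i); [exists i|exists x].
have [a aP] := hI h; have [i /aP[Ii hia]] := ccof a _ (gb a).
by rewrite ltNge hP.
Qed.

(** Each [b a] is a limit, so any [g] is exceeded at every coordinate. This gives [min_card] a
    nonempty collection to minimise over. *)
Lemma prod_below_unbounded : is_unbounded b (prod_below b).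
Proof.
split=> // -[g gb gmax].
have /choice[f fP] : forall a, exists y, g a < y < b a.
  move=> a; have [y gy yb] := infinite_cardinal_limit (hb_card a) (gb a).
  by exists y; rewrite gy.
have [|x xP] := gmax f; first by move=> a; case/andP: (fP a).
have [a xa] := no_max x; have /andP[+ _] := fP a.
by rewrite ltNge xP.
Qed.

(** The representing set is itself an unbounded family, so bounds proved for such families apply to
    it directly. *)
Lemma unbounding_number_exists :
  exists X : set (K -> K), is_unbounded b X /\ is_unbounding_number b X.
Proof.
have [|X Xu Xmin] := @min_card _ (is_unbounded b).
  by exists (prod_below b); exact: prod_below_unbounded.
by exists X; split=> //; split=> //; exists X => //; exact: card_eqxx.
Qed.

Lemma unbounding_number_least_level l :
  is_least [set m : K | is_regular m /\
              cofinal_in (cof_level b m) [set: K]] l ->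
  is_unbounding_number b (below l).
Proof.
move=> [[lreg [_ lcof]] lmin].
have [c cb ccof] := cofinal_family.
apply: (@unbounding_numberI _ _ c).
  apply: cofinal_family_unbounded => // h.
  have [x xP] := small_family_bounded_kappa h (@below_small l).
  have [a al xa] := lcof x I; exists a => i; rewrite al => il; split=> //.
  exact: lt_le_trans (xP i il) xa.
move=> B [Bb Bunb]; apply: contrapT => nB; apply: Bunb.
have [m ml mreg|x xP] := @cf_eventually_ge l.
  apply: contrapT => nx; move: ml; rewrite ltNge lmin//; split=> //.
  split=> // x _; apply: contrapT => na; apply: nx; exists x => a am.
  by rewrite ltNge; apply/negP => xa; apply: na; exists a.
apply: (small_set_bounded Bb (x := x)) => a /xP la cfB; apply: nB.
by apply: card_le_trans cfB; exact/subset_card_le/below_sub.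
Qed.

(** * Cases (ii) and (iii): every level is bounded *)

Hypothesis level_bounded :
  forall l, is_regular l -> has_ubound (cof_level b l).

Lemma cf_eventually_gt l : exists x, forall a, x <= a -> l < cf (b a).
Proof.
have [l' ll'] := no_max l; have [m _ mreg|x xP] := @cf_eventually_ge l'.
  have [y yub] := level_bounded mreg; have [x yx] := no_max y.
  by exists x => a /yub ay; exact: le_lt_trans yx.
by exists x => a /xP; exact: lt_le_trans.
Qed.

(** A family smaller than kappa has the size of some [below l], whereas [cf (b a)] is eventually a
    cardinal above [l]. *)
Lemma unbounding_number_ge_kappa (B : set (K -> K)) :
  is_unbounded b B -> [set: K] #<= B.
Proof.
move=> [Bb Bunb]; apply: contrapT => nB; apply: Bunb.
have [//|/card_subP[A AB _]] := card_le_total [set: K] B.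
have [[AK _]|[l Al _]] := card_initial_segment_below wo A.
  by case: nB; rewrite -(card_le_eqr AB) (card_le_eqr AK).
have [x xP] := cf_eventually_gt l.
apply: (small_set_bounded Bb (x := x)) => a /xP la.
rewrite -(card_le_eqr AB) (card_le_eqr Al).
by have [] := is_cardinal_cf wo la.
Qed.

Lemma unbounding_number_stationary (S : set K) : is_stationary S ->
  (forall x, S x -> exists2 a, x <= a & cf (b a) <= x) ->
  is_unbounding_number b [set: K].
Proof.
move=> Sstat Scf; have [c cb ccof] := cofinal_family.
apply: (@unbounding_numberI _ _ c); last exact: unbounding_number_ge_kappa.
apply: cofinal_family_unbounded => // h.
have [x [/Scf[a xa cfx] xh]] := Sstat _ (closure_points_club h).
exists a => i icf; split=> //; apply: lt_le_trans xa.
exact/xh/(lt_le_trans icf).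
Qed.

Lemma unbounded_gt_kappa C (B : set (K -> K)) : is_club C ->
  (forall x, C x -> forall a, x <= a -> x < cf (b a)) ->
  is_unbounded b B -> ~ (B #<= [set: K]).
Proof.
move=> Cclub Ccf [Bb Bunb] /card_le_relP[G Gtot Ginj]; apply: Bunb.
have /choice[g gP] : forall a, exists y, y < b a /\ forall f i c, B f ->
    G f i -> C c -> i < c -> c <= a -> f a < y.
  move=> a; have [[c [Cc ca]]|nc] := pselect (exists c, C c /\ c <= a);
    last first.
    have [y yb] := infinite_cardinal_gt0 (hb_card a); exists y; split=> //.
    by move=> f i c _ _ Cc _ ca; case: nc; exists c.
  have [z [Cz za zmax]] := club_max Cclub Cc ca.
  have [||y yb yP] := small_family_bounded wo (F := fun f : K -> K => f a)
      (S := [set f | B f /\ exists2 i, i < z & G f i]) (x := b a).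
  (* [G] injects these functions into [below z], which is smaller than the cardinal [cf (b a)] since
     [z] is in [C] and [z <= a]. *)
  - move=> cfS; have [_] := is_cardinal_cf wo (Ccf z Cz a za); apply.
    apply: card_le_trans cfS _; apply/card_le_relP; exists G.
      by move=> f [_ [i]]; exists i.
    by move=> f f' i [Bf _] [Bf' _]; exact: Ginj.
  - by move=> f [Bf _]; exact: Bb.
  exists y; split=> // f i c' Bf Gfi Cc' ic' c'a; apply: yP; split=> //.
  by exists i => //; apply: lt_le_trans ic' _; exact: zmax.
exists g => [a|f Bf]; first by case: (gP a).
(* Cofinality of [C] gives only [j <= c], so a [j] above the index [i] of [f] is chosen to get
   [i < c]. *)
have [i _ Gfi] := Gtot f Bf; have [j ij] := no_max i.
have [c Cc jc] := Cclub.1.2 j I.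
exists c => a /ltW ca; apply/ltW; have [_ gub] := gP a.
exact: gub Bf Gfi Cc (lt_le_trans ij jc) ca.
Qed.

End Inaccessible.

(** * Successor cardinals and the theorem *)

(** By Cantor's theorem some set of subsets of [T] is larger than [T]; take a smallest one, [Y]. Any
    [Z] not above [Y] embeds into [Y], so it has a copy among the competitors. *)
Lemma succ_card_exists T :
  exists Y : set (set T), is_succ_card [set: T] Y.
Proof.
have [|Y TY Ymin] := @min_card _ [set Y : set (set T) | card_lt [set: T] Y].
  by exists [set: set T]; exact: card_lt_setT_powerset.
exists Y; split=> // V Z [TZ nZT].
have [//|/card_subP[C CZ _]] := card_le_total Y Z.
rewrite -(card_le_eqr CZ); apply: Ymin.
by split; [rewrite (card_le_eqr CZ)|rewrite (card_le_eql CZ)].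
Qed.

(** In (iii) both cardinals may exceed kappa and are represented by sets. [X] and [Y] are determined
    up to equinumerosity, so exhibiting one pair suffices. *)
Theorem lemma3p3 (d : Order.disp_t) (K : orderType d) (b : K -> K)
    (hK : inaccessible K)
    (hb_incr : {homo b : x y / x <= y})
    (hb_card : forall a : K, is_infinite_cardinal (b a)) :
  [/\ (forall l : K,
         is_least [set m : K | is_regular m /\
                     cofinal_in (cof_level b m) [set: K]] l ->
         is_unbounding_number b (below l)),
      ((forall l : K, is_regular l -> has_ubound (cof_level b l)) ->
       (exists S : set K, is_stationary S /\
          forall xi : K, S xi -> exists2 a : K, xi <= a & cf (b a) <= xi) ->
       is_unbounding_number b [set: K]) &
      ((forall l : K, is_regular l -> has_ubound (cof_level b l)) ->
       (exists C : set K, is_club C /\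
          forall xi : K, C xi -> forall a : K, xi <= a -> xi < cf (b a)) ->
       exists (T U : Type) (X : set T) (Y : set U),
         [/\ is_unbounding_number b X, is_succ_card [set: K] Y & Y #<= X])].
Proof.
split=> [l|hD [S [Sstat Scf]]|hD [C [Cclub Ccf]]].
- exact: unbounding_number_least_level.
- exact: unbounding_number_stationary Sstat Scf.
have [X [Xu Xnum]] := unbounding_number_exists hK hb_card.
have [Y Ysucc] := succ_card_exists K.
exists (K -> K), (set K), X, Y; split=> //.
have nXK := unbounded_gt_kappa hK hb_card Cclub Ccf Xu.
apply: Ysucc.2; split=> //.
by case: (card_le_total [set: K] X).
Qed.
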